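(* Let $(\mathcal{S},\{\phi_{k,\infty}\}_{k\in\mathbb{N}})$ and $(\mathcal{T},\{\psi_{k,\infty}\}_{k\in\mathbb{N}})$ be inductive limits, in the operator system category, of the inductive systems $$\mathcal{S}_1\xrightarrow{\phi_1}\mathcal{S}_2\xrightarrow{\phi_2}\mathcal{S}_3\xrightarrow{\phi_3}\mathcal{S}_4\xrightarrow{\phi_4}\cdots\qquad\text{and}\qquad \mathcal{T}_1\xrightarrow{\psi_1}\mathcal{T}_2\xrightarrow{\psi_2}\mathcal{T}_3\xrightarrow{\psi_3}\mathcal{T}_4\xrightarrow{\psi_4}\cdots$$ respectively. Then the pair $(\mathcal{S}\oplus_1\mathcal{T},\{\phi_{k,\infty}\oplus_1\psi_{k,\infty}\}_{k\in\mathbb{N}})$ is an inductive limit for the inductive system $$\mathcal{S}_1\oplus_1\mathcal{T}_1\xrightarrow{\phi_1\oplus_1\psi_1}\mathcal{S}_2\oplus_1\mathcal{T}_2\xrightarrow{\phi_2\oplus_1\psi_2}\mathcal{S}_3\oplus_1\mathcal{T}_3\xrightarrow{\phi_3\oplus_1\psi_3}\cdots,$$ where for each $k\in\mathbb{N}$ the map $\phi_k\oplus_1\psi_k:\mathcal{S}_k\oplus_1\mathcal{T}_k\to\mathcal{S}_{k+1}\oplus_1\mathcal{T}_{k+1}$ is the unique unital completely positive map associated with the maps $\phi_k$ and $\psi_k$ after embedding both $\mathcal{S}_{k+1}$ and $\mathcal{T}_{k+1}$ in $\mathcal{S}_{k+1}\oplus_1\mathcal{T}_{k+1}$.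
   Context: An operator system is a matrix ordered $*$-vector space with an Archimedean matrix order unit; morphisms are unital completely positive (ucp) maps. $\mathcal{S}\oplus_1\mathcal{T}$ denotes the coproduct of operator systems $\mathcal{S},\mathcal{T}$ amalgamated over the unit: the operator system, unique up to complete order isomorphism, together with unital complete order embeddings $\mathcal{S}\hookrightarrow\mathcal{S}\oplus_1\mathcal{T}$ and $\mathcal{T}\hookrightarrow\mathcal{S}\oplus_1\mathcal{T}$ such that for all ucp maps $\alpha:\mathcal{S}\to\mathcal{R}$, $\beta:\mathcal{T}\to\mathcal{R}$ into an operator system $\mathcal{R}$ there is a unique ucp map $\mathcal{S}\oplus_1\mathcal{T}\to\mathcal{R}$ restricting to $\alpha$ on $\mathcal{S}$ and to $\beta$ on $\mathcal{T}$. For ucp maps $\alpha:\mathcal{S}\to\mathcal{S}'$, $\beta:\mathcal{T}\to\mathcal{T}'$, the map $\alpha\oplus_1\beta:\mathcal{S}\oplus_1\mathcal{T}\to\mathcal{S}'\oplus_1\mathcal{T}'$ is the unique ucp map restricting to $\alpha$ on $\mathcal{S}$ and to $\beta$ on $\mathcal{T}$ (with $\mathcal{S}',\mathcal{T}'$ viewed inside $\mathcal{S}'\oplus_1\mathcal{T}'$); in particular this defines $\phi_{k,\infty}\oplus_1\psi_{k,\infty}:\mathcal{S}_k\oplus_1\mathcal{T}_k\to\mathcal{S}\oplus_1\mathcal{T}$. An inductive system of operator systems is a pair $(\{\mathcal{S}_k\}_{k\in\mathbb{N}},\{\phi_k\}_{k\in\mathbb{N}})$ with each $\mathcal{S}_k$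 an operator system and $\phi_k:\mathcal{S}_k\to\mathcal{S}_{k+1}$ ucp. An inductive limit of it is a pair $(\mathcal{S},\{\phi_{k,\infty}\}_{k\in\mathbb{N}})$ with $\mathcal{S}$ an operator system and $\phi_{k,\infty}:\mathcal{S}_k\to\mathcal{S}$ ucp such that (1) $\phi_{k+1,\infty}\circ\phi_k=\phi_{k,\infty}$ for all $k$, and (2) if $(\mathcal{R},\{\rho_k\}_{k})$ is another pair with $\mathcal{R}$ an operator system and $\rho_k:\mathcal{S}_k\to\mathcal{R}$ ucp with $\rho_{k+1}\circ\phi_k=\rho_k$ for all $k$, then there is a unique ucp map $\mu:\mathcal{S}\to\mathcal{R}$ with $\mu\circ\phi_{k,\infty}=\rho_k$ for all $k$. *)

(* Defs.v *)
From HB Require Import structures.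
From mathcomp Require Import all_boot all_order all_algebra.
From mathcomp Require Import boolp reals.
From mathcomp Require Import complex.

Set Implicit Arguments.
Unset Strict Implicit.
Unset Printing Implicit Defensive.

Import Order.TTheory GRing.Theory Num.Theory.

Local Open Scope ring_scope.
Local Open Scope complex_scope.

(* Matrices over a complex *-vector space V with involution st:               *)
(*   mxstar st X == the involution (x_ij)^* = (x_ji^* )_ij of M_n(V)           *)
(*   mxscale c X == the scalar multiple c X                                   *)
(*   mxconj A X  == the product A^* X A in M_m(V), for A an n x m complex      *)
(*                  matrix and X in M_n(V)                                    *)
(*   mxdiag1 n e == the diagonal matrix diag(e, ..., e) of M_n(V)             *)
Section MatrixOps.
Variables (R : realType) (V : lmodType R[i]).

Definition mxstar (st : V -> V) n (X : 'M[V]_n) : 'M[V]_n := map_mx st X^T.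

Definition mxscale (c : R[i]) n (X : 'M[V]_n) : 'M[V]_n := map_mx ( *:%R c) X.

Definition mxconj n m (A : 'M[R[i]]_(n, m)) (X : 'M[V]_n) : 'M[V]_m :=
  \matrix_(i, j) \sum_(k < n) \sum_(l < n) (Num.conj (A k i) * A l j) *: X k l.

Definition mxdiag1 n (e : V) : 'M[V]_n :=
  \matrix_(i, j) if i == j then e else 0.

End MatrixOps.

(* The size n = 0 is allowed: M_0(V) is a single point and the axioms force    *)
(* it to be positive, so nothing is added to the usual levels n >= 1.         *)
HB.mixin Record isOperatorSystem (R : realType) V of GRing.Lmodule R[i] V := {
  star : V -> V;
  starK : involutive star;
  starD : {morph star : x y / x + y};
  starZ : forall (c : R[i]) (x : V), star (c *: x) = Num.conj c *: star x;
  mxpos : forall n, 'M[V]_n -> Prop;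
  mxpos_star : forall n (X : 'M[V]_n), mxpos n X -> mxstar star X = X;
  mxpos0 : forall n, mxpos n (0 : 'M[V]_n);
  mxposD : forall n (X Y : 'M[V]_n), mxpos n X -> mxpos n Y -> mxpos n (X + Y);
  mxposZ : forall n (r : R) (X : 'M[V]_n),
    0 <= r -> mxpos n X -> mxpos n (mxscale r%:C X);
  mxpos_proper : forall n (X : 'M[V]_n), mxpos n X -> mxpos n (- X) -> X = 0;
  mxpos_conj : forall n m (A : 'M[R[i]]_(n, m)) (X : 'M[V]_n),
    mxpos n X -> mxpos m (mxconj A X);
  ounit : V;
  star_ounit : star ounit = ounit;
  mx_ounit : forall n (X : 'M[V]_n), mxstar star X = X ->
    exists2 r : R, 0 < r & mxpos n (mxscale r%:C (mxdiag1 n ounit) + X);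
  mx_archimedean : forall n (X : 'M[V]_n),
    (forall r : R, 0 < r -> mxpos n (mxscale r%:C (mxdiag1 n ounit) + X)) ->
    mxpos n X
}.

#[short(type="opSystemType")]
HB.structure Definition OperatorSystem (R : realType) :=
  {V of isOperatorSystem R V & GRing.Lmodule R[i] V}.

Arguments ounit {R s}.
Arguments mxpos {R s n}.

HB.mixin Record isUCP (R : realType) (S T : opSystemType R) (f : S -> T) := {
  ucp_unit : f ounit = ounit;
  ucp_pos : forall n (X : 'M[S]_n), mxpos X -> mxpos (map_mx f X)
}.

#[short(type="ucpType")]
HB.structure Definition UCP (R : realType) (S T : opSystemType R) :=
  {f of isUCP R S T f & @GRing.Linear R[i] S T *:%R f}.

Notation "{ 'ucp' S -> T }" := (ucpType S%type T%type)
  (at level 0, S at level 98, T at level 99, format "{ 'ucp'  S  ->  T }").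

Section UCPComp.
Variables (R : realType) (S T Q : opSystemType R).
Variables (g : {ucp T -> Q}) (f : {ucp S -> T}).

Fact comp_ucp_unit : (g \o f) ounit = ounit.
Proof. by rewrite /= !ucp_unit. Qed.

Fact comp_ucp_pos n (X : 'M[S]_n) : mxpos X -> mxpos (map_mx (g \o f) X).
Proof. by move=> /(ucp_pos (s := f)) /(ucp_pos (s := g)); rewrite -map_mx_comp. Qed.

HB.instance Definition _ :=
  isUCP.Build R S Q (g \o f) comp_ucp_unit comp_ucp_pos.

End UCPComp.

Definition complete_order_embedding (R : realType) (S T : opSystemType R)
    (f : {ucp S -> T}) : Prop :=
  injective f /\ forall n (X : 'M[S]_n), mxpos (map_mx f X) -> mxpos X.

(* A coproduct of S and T amalgamated over the unit. It is determined up to   *)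
(* complete order isomorphism; an element of this type is a choice of one.    *)
Record coproduct (R : realType) (S T : opSystemType R) := Coproduct {
  coprod_obj :> opSystemType R;
  coprod_inl : {ucp S -> coprod_obj};
  coprod_inr : {ucp T -> coprod_obj};
  coprod_inl_embedding : complete_order_embedding coprod_inl;
  coprod_inr_embedding : complete_order_embedding coprod_inr;
  coprod_universal : forall (Q : opSystemType R)
      (alpha : {ucp S -> Q}) (beta : {ucp T -> Q}),
    exists mu : {ucp coprod_obj -> Q},
      [/\ mu \o coprod_inl =1 alpha, mu \o coprod_inr =1 beta
        & forall nu : {ucp coprod_obj -> Q},
            nu \o coprod_inl =1 alpha -> nu \o coprod_inr =1 beta -> nu =1 mu]
}.

Arguments coprod_inl {R S T} c.
Arguments coprod_inr {R S T} c.

Section CoprodMap.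
Variables (R : realType) (S T S' T' : opSystemType R).
Variables (U : coproduct S T) (U' : coproduct S' T').
Variables (alpha : {ucp S -> S'}) (beta : {ucp T -> T'}).

Definition coprod_map : {ucp U -> U'} :=
  sval (cid (coprod_universal U (coprod_inl U' \o alpha)
                                (coprod_inr U' \o beta))).

Lemma coprod_map_inl : coprod_map \o coprod_inl U =1 coprod_inl U' \o alpha.
Proof. by rewrite /coprod_map; case: cid => mu []. Qed.

Lemma coprod_map_inr : coprod_map \o coprod_inr U =1 coprod_inr U' \o beta.
Proof. by rewrite /coprod_map; case: cid => mu []. Qed.

Lemma coprod_map_unique (nu : {ucp U -> U'}) :
  nu \o coprod_inl U =1 coprod_inl U' \o alpha ->
  nu \o coprod_inr U =1 coprod_inr U' \o beta -> nu =1 coprod_map.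
Proof. by rewrite /coprod_map; case: cid => mu [? ? umu] /=; exact: umu. Qed.

End CoprodMap.

Definition inductive_limit (R : realType) (S_ : nat -> opSystemType R)
    (phi : forall k, {ucp S_ k -> S_ k.+1})
    (S : opSystemType R) (phioo : forall k, {ucp S_ k -> S}) : Prop :=
  (forall k, phioo k.+1 \o phi k =1 phioo k) /\
  (forall (Q : opSystemType R) (rho : forall k, {ucp S_ k -> Q}),
     (forall k, rho k.+1 \o phi k =1 rho k) ->
     exists mu : {ucp S -> Q},
       (forall k, mu \o phioo k =1 rho k) /\
       (forall nu : {ucp S -> Q},
          (forall k, nu \o phioo k =1 rho k) -> nu =1 mu)).

(* Main.v *)
Require Import Defs.
From mathcomp Require Import all_boot all_order all_algebra.
From mathcomp Require Import boolp reals.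

(** The statement is formal: colimits commute with colimits.  A ucp map out of
    a unital coproduct is the same thing as a pair of ucp maps out of the two
    summands, and a ucp map out of an inductive limit is the same thing as a
    compatible family.  Precomposing a family compatible with the maps
    [phi k (+) psi k] with the left and right inclusions therefore splits it
    into one family compatible with [phi] and one compatible with [psi]; these
    factor through [S] and [T], and the two factorizations glue to a map on
    the coproduct of [S] and [T].  Each equality of ucp maps needed on the way
    is tested on the two summands ([coproduct_ext]), where [coprod_map] acts
    by its two components. *)

(** The two inclusions are jointly epimorphic: this is the uniqueness half of
    the universal property, applied to the pair of restrictions of [mu]. *)
Lemma coproduct_ext (R : realType) (S T Q : opSystemType R)
    (U : coproduct S T) (mu nu : {ucp U -> Q}) :
  mu \o coprod_inl U =1 nu \o coprod_inl U ->
  mu \o coprod_inr U =1 nu \o coprod_inr U ->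
  mu =1 nu.
Proof.
move=> eql eqr x.
have [lam [_ _ lam_uniq]] :=
  coprod_universal U (mu \o coprod_inl U) (mu \o coprod_inr U).
have -> : mu x = lam x by exact: lam_uniq.
by apply/esym/lam_uniq => y; [rewrite -eql | rewrite -eqr].
Qed.

Theorem proposition6p2 (R : realType)
  (S_ T_ : nat -> opSystemType R)
  (phi : forall k, {ucp S_ k -> S_ k.+1})
  (psi : forall k, {ucp T_ k -> T_ k.+1})
  (S T : opSystemType R)
  (phioo : forall k, {ucp S_ k -> S})
  (psioo : forall k, {ucp T_ k -> T})
  (hS : inductive_limit phi phioo)
  (hT : inductive_limit psi psioo)
  (U_ : forall k, coproduct (S_ k) (T_ k))
  (U : coproduct S T) :
  inductive_limit
    (fun k => coprod_map (U_ k) (U_ k.+1) (phi k) (psi k))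
    (fun k => coprod_map (U_ k) U (phioo k) (psioo k)).
Proof.
have [phiooE univS] := hS; have [psiooE univT] := hT.
have mapl S1 T1 S2 T2 (U1 : coproduct S1 T1) (U2 : coproduct S2 T2) a b x :
    coprod_map U1 U2 a b (coprod_inl U1 x) = coprod_inl U2 (a x).
  exact: coprod_map_inl.
have mapr S1 T1 S2 T2 (U1 : coproduct S1 T1) (U2 : coproduct S2 T2) a b x :
    coprod_map U1 U2 a b (coprod_inr U1 x) = coprod_inr U2 (b x).
  exact: coprod_map_inr.
split=> [k|Q rho rhoE].
  apply: coproduct_ext => x /=.
    by rewrite !mapl -(phiooE k).
  by rewrite !mapr -(psiooE k).
have [k x|a [aE a_uniq]] := univS Q (fun k => rho k \o coprod_inl (U_ k)).
  by rewrite /= -(rhoE k) /= mapl.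
have [k x|b [bE b_uniq]] := univT Q (fun k => rho k \o coprod_inr (U_ k)).
  by rewrite /= -(rhoE k) /= mapr.
have [mu [mul mur mu_uniq]] := coprod_universal U a b.
exists mu; split=> [k|nu nuE].
  apply: coproduct_ext => x /=.
    by rewrite mapl; apply: etrans (mul _) (aE k x).
  by rewrite mapr; apply: etrans (mur _) (bE k x).
(* The restrictions of nu to S and T factor the two split families, hence
   they are a and b. *)
apply: mu_uniq.
  by apply: (a_uniq (nu \o coprod_inl U)) => k x; rewrite /= -(nuE k) /= mapl.
by apply: (b_uniq (nu \o coprod_inr U)) => k x; rewrite /= -(nuE k) /= mapr.
Qed.
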